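(* Let $N_1,N_2\ge 0$ and let $(u(r),v(r))$ be an entire radial solution of the system $$\begin{cases}\Delta u=-2e^u+e^v+4e^{2u}-2e^{2v}-e^{u+v}+4\pi N_1\delta_0\\ \Delta v=e^u-2e^v-2e^{2u}+4e^{2v}-e^{u+v}+4\pi N_2\delta_0\end{cases}\quad\text{in }\mathbb{R}^2$$ which is a non-topological or a mixed-type solution. Let $f_1(r)=e^{u(r)}-2e^{2u(r)}+e^{u(r)+v(r)}$ and $f_2(r)=e^{v(r)}-2e^{2v(r)}+e^{u(r)+v(r)}$. Then $f_1(r)>0$ and $f_2(r)>0$ for all sufficiently large $r$.
   Context: Here $\delta_0$ is the Dirac measure at the origin of $\mathbb{R}^2$ and $r=|x|$. An entire radial solution is a pair of functions $u(r),v(r)$ defined for all $r\in(0,\infty)$, satisfying the system away from the origin, i.e. $u_{rr}+\frac1r u_r=-2e^u+e^v+4e^{2u}-2e^{2v}-e^{u+v}$ and $v_{rr}+\frac1r v_r=e^u-2e^v-2e^{2u}+4e^{2v}-e^{u+v}$ on $(0,\infty)$, and satisfying $u(r)=2N_1\log r+O(1)$, $v(r)=2N_2\log r+O(1)$ as $r\to0^+$ (with Dirac masses $4\pi N_1$, $4\pi N_2$ at the origin, so that $ru_r\to 2N_1$ and $rv_r\to 2N_2$ as $r\to 0^+$). Such a solution is called non-topological if $(u,v)\to(-\infty,-\infty)$ as $r\to\infty$, and mixed-type if $(u,v)\to(\log\frac12,-\infty)$ or $(u,v)\to(-\infty,\log\frac12)$ as $r\to\infty$. *)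

(* Defs.v *)
From Stdlib Require Import Reals.
From Coquelicot Require Import Coquelicot.
Open Scope R_scope.

(* Profiles u, v : R -> R are total functions; only their values on (0, +oo)
   matter below. *)

(* Right-hand side of the first equation away from the origin; the second one
   is obtained by exchanging the two arguments. *)
Definition rhs (a b : R) : R :=
  - 2 * exp a + exp b + 4 * exp (2 * a) - 2 * exp (2 * b) - exp (a + b).

Definition twice_derivable (w : R -> R) : Prop :=
  forall r, 0 < r -> ex_derive w r /\ ex_derive (Derive w) r.

Definition radial_laplacian (w : R -> R) (r : R) : R :=
  Derive_n w 2 r + / r * Derive w r.

(* w = 2 N log r + O(1) as r -> 0+, together with r w_r -> 2 N, which is the
   radial form of the Dirac mass 4 pi N at the origin:
   the flux of grad w through the circle of radius r is 2 pi r w_r. *)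
Definition singular_at_origin (N : R) (w : R -> R) : Prop :=
  (exists M, at_right 0 (fun r => Rabs (w r - 2 * N * ln r) <= M)) /\
  filterlim (fun r => r * Derive w r) (at_right 0) (locally (2 * N)).

Definition entire_radial_solution (N1 N2 : R) (u v : R -> R) : Prop :=
  twice_derivable u /\ twice_derivable v /\
  (forall r, 0 < r -> radial_laplacian u r = rhs (u r) (v r)) /\
  (forall r, 0 < r -> radial_laplacian v r = rhs (v r) (u r)) /\
  singular_at_origin N1 u /\ singular_at_origin N2 v.

Definition non_topological (u v : R -> R) : Prop :=
  is_lim u p_infty m_infty /\ is_lim v p_infty m_infty.

Definition mixed_type (u v : R -> R) : Prop :=
  (is_lim u p_infty (ln (1 / 2)) /\ is_lim v p_infty m_infty) \/
  (is_lim u p_infty m_infty /\ is_lim v p_infty (ln (1 / 2))).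

Definition f1 (u v : R -> R) (r : R) : R :=
  exp (u r) - 2 * exp (2 * u r) + exp (u r + v r).

Definition f2 (u v : R -> R) (r : R) : R :=
  exp (v r) - 2 * exp (2 * v r) + exp (u r + v r).

(* Main.v *)
Require Import Defs.
From Stdlib Require Import Reals Lra Classical.
From Coquelicot Require Import Coquelicot.
Open Scope R_scope.

(** The only delicate case is u -> log (1/2), v -> -oo, and there the only
    delicate claim is that g = 1 - 2 e^u + e^v is eventually positive, since
    f_1 = e^u g.  The function V = v + u/2 satisfies
    Delta V = -(3/2) f_2, which is comparable with -e^V; a Liouville-type
    argument shows that r V' stays bounded, so that e^v cannot decay
    exponentially fast and V' -> 0.  The equation for g then gives
    Delta g <= g/4 - e^{-r/2} wherever g <= 0 and r is large.  By the maximum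
    principle, g is either eventually positive or nonpositive and nondecreasing
    near infinity; in the second case -g would decay at least like e^{-r/2},
    which the source term e^{-r/2} rules out. *)

(** * One-variable calculus: monotonicity and minima *)

(** Discharges the differentiability side conditions of [auto_derive] from [is_derive] facts already
    in context. *)
Ltac ex_derive_known :=
  repeat match goal with
  | |- _ /\ _ => split
  | |- True => exact I
  | |- ex_derive _ _ => eexists; eassumption
  | |- _ <> _ => lra
  end.

Lemma nondecreasing_of_derive (F F1 : R -> R) (R0 : R) :
  (forall r, R0 < r -> is_derive F r (F1 r)) ->
  (forall r, R0 < r -> 0 <= F1 r) ->
  forall x y, R0 < x -> x <= y -> F x <= F y.
Proof.
  intros HF HF1 x y Hx Hxy.
  destruct (MVT_gen F x y F1) as [c [Hc E]];
    rewrite ?Rmin_left, ?Rmax_right in * by lra.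
  - intros z Hz; apply HF; lra.
  - intros z Hz; apply continuity_pt_filterlim.
    apply (ex_derive_continuous F); exists (F1 z); apply HF; lra.
  - assert (0 <= F1 c) by (apply HF1; lra). nra.
Qed.

Lemma nonincreasing_of_derive (F F1 : R -> R) (R0 : R) :
  (forall r, R0 < r -> is_derive F r (F1 r)) ->
  (forall r, R0 < r -> F1 r <= 0) ->
  forall x y, R0 < x -> x <= y -> F y <= F x.
Proof.
  intros HF HF1 x y Hx Hxy.
  enough (- F x <= - F y) by lra.
  apply (nondecreasing_of_derive (fun r => - F r) (fun r => - F1 r) R0); auto.
  - intros r Hr. apply (is_derive_opp F). auto.
  - intros r Hr. specialize (HF1 r Hr). lra.
Qed.

(** If [g2 s] were negative, the vanishing [g1] would turn negative just to the right of [s], and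
    [g] would drop below its minimum there. *)
Lemma interior_min_derive (g g1 g2 : R -> R) (a b s : R) :
  a < s < b ->
  (forall x, a < x < b -> is_derive g x (g1 x)) ->
  is_derive g1 s (g2 s) ->
  (forall x, a < x < b -> g s <= g x) ->
  g1 s = 0 /\ 0 <= g2 s.
Proof.
  intros Hs Hg Hg1 Hmin.
  assert (Z : g1 s = 0).
  { assert (D := proj1 (is_derive_Reals _ _ _) (Hg s Hs)).
    (* With this witness [derive_pt g s pr] reduces to [g1 s]. *)
    set (pr := exist _ (g1 s) D : derivable_pt g s).
    change (derive_pt g s pr = 0).
    apply (deriv_minimum g a b); auto; lra. }
  split; [exact Z|].
  apply Rnot_lt_le; intro N.
  assert (D := proj1 (is_derive_Reals _ _ _) Hg1).
  destruct (D (- g2 s / 2) ltac:(lra)) as [d Hd].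
  set (t := Rmin (d / 2) ((b - s) / 2)).
  assert (Ht : 0 < t) by (apply Rmin_pos; [pose proof (cond_pos d)|]; lra).
  assert (Htd : t <= d / 2) by apply Rmin_l.
  assert (Htb : t <= (b - s) / 2) by apply Rmin_r.
  pose proof (cond_pos d) as Hdp.
  destruct (MVT_cor2 g g1 s (s + t)) as [c [E Hc]]; [lra| |].
  { intros c Hc. apply is_derive_Reals, Hg. lra. }
  assert (g s <= g (s + t)) by (apply Hmin; lra).
  assert (Hneg : g1 c < 0).
  { specialize (Hd (c - s) ltac:(lra)).
    rewrite Rabs_pos_eq in Hd by lra. specialize (Hd ltac:(lra)).
    replace (s + (c - s)) with c in Hd by ring. rewrite Z, Rminus_0_r in Hd.
    apply Rabs_def2 in Hd.
    assert (Hq : g1 c / (c - s) < 0) by lra.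
    replace (g1 c) with (g1 c / (c - s) * (c - s)) by (field; lra). nra. }
  nra.
Qed.

(** * Minimum principle near infinity *)

(** A nonpositive interior minimum would have g' = 0 and g'' >= 0, against strict superharmonicity.
    The limit 0 rules out an escape of the minimum to infinity. *)
Lemma min_principle_at_infinity (g g1 g2 : R -> R) (R0 : R) :
  0 <= R0 ->
  (forall r, R0 < r -> is_derive g r (g1 r)) ->
  (forall r, R0 < r -> is_derive g1 r (g2 r)) ->
  is_lim g p_infty 0 ->
  (forall r, R0 < r -> g r <= 0 -> g2 r + / r * g1 r < 0) ->
  forall x y, R0 < x -> x <= y -> g y <= 0 -> g x <= g y.
Proof.
  intros HR0 Hg Hg1 Hlim Hsup.
  assert (Hint : forall a b s, R0 < a -> a < s < b -> g s <= 0 ->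
      (forall x, a < x < b -> g s <= g x) -> False).
  { intros a b s Ha Hs Hgs Hm.
    destruct (interior_min_derive g g1 g2 a b s Hs) as [Z P]; auto.
    - intros x Hx; apply Hg; lra.
    - apply Hg1; lra.
    - specialize (Hsup s ltac:(lra) Hgs). rewrite Z in Hsup. lra. }
  assert (Hneg : forall x y, R0 < x -> x <= y -> g y < 0 -> g x <= g y).
  { intros x y Hx Hxy Hy. apply Rnot_lt_le; intro N.
    apply is_lim_spec in Hlim.
    destruct (Hlim (mkposreal (- g y) ltac:(lra))) as [M HM]; simpl in HM.
    (* Beyond [M], g exceeds the negative value [g y], so the minimum over [x, T] is attained at
       neither endpoint. *)
    set (T := Rmax M y + 1).
    assert (M <= Rmax M y) by apply Rmax_l.
    assert (y <= Rmax M y) by apply Rmax_r.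
    assert (HT : g y < g T).
    { specialize (HM T ltac:(unfold T; lra)). apply Rabs_def2 in HM. lra. }
    destruct (continuity_ab_min g x T) as [s [Hs1 Hs2]]; [unfold T; lra| |].
    { intros c Hc. apply continuity_pt_filterlim.
      apply (ex_derive_continuous g); exists (g1 c); apply Hg; lra. }
    assert (g s <= g y) by (apply Hs1; unfold T; lra).
    assert (s <> x) by (intro; subst; lra).
    assert (s <> T) by (intro E; rewrite E in *; lra).
    apply (Hint x T s); try lra. intros z Hz; apply Hs1; lra. }
  intros x y Hx Hxy Hy.
  (* If [g y] = 0, then [y] itself is the minimum on (x, y + 1): a smaller value would be negative,
     and the strict case would force [g x] below 0. *)
  destruct (Rlt_le_dec (g y) 0) as [L|L]; [auto|].
  apply Rnot_lt_le; intro N.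
  assert (x <> y) by (intro; subst; lra).
  apply (Hint x (y + 1) y); try lra.
  intros z Hz. apply Rnot_lt_le; intro N'.
  assert (g x <= g z) by (apply Hneg; lra). lra.
Qed.

Lemma exp_half_sq r : exp (r / 2) * exp (- r / 2) = 1.
Proof. rewrite <- exp_plus, <- exp_0. f_equal. lra. Qed.

Lemma eventually_positive_of_superharmonic (g g1 g2 : R -> R) (R0 : R) :
  0 <= R0 ->
  (forall r, R0 < r -> is_derive g r (g1 r)) ->
  (forall r, R0 < r -> is_derive g1 r (g2 r)) ->
  is_lim g p_infty 0 ->
  (forall r, R0 < r -> g r <= 0 ->
     g2 r + / r * g1 r <= g r / 4 - exp (- r / 2)) ->
  exists R1, forall r, R1 < r -> 0 < g r.
Proof.
  intros HR0 Hg Hg1 Hlim Hsup.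
  apply NNPP; intro N.
  assert (Hfar : forall x, exists y, x < y /\ g y <= 0).
  { intros x. apply NNPP; intro N'. apply N. exists x. intros r Hr.
    apply Rnot_le_lt; intro. apply N'. now exists r. }
  assert (Hmin : forall x y, R0 < x -> x <= y -> g y <= 0 -> g x <= g y).
  { apply (min_principle_at_infinity g g1 g2); auto.
    intros r Hr Hgr. specialize (Hsup r Hr Hgr).
    pose proof (exp_pos (- r / 2)). lra. }
  assert (Hle : forall x, R0 < x -> g x <= 0).
  { intros x Hx. destruct (Hfar x) as [y [Hy Hgy]].
    assert (g x <= g y) by (apply Hmin; lra). lra. }
  assert (Hg1pos : forall x, R0 < x -> 0 <= g1 x).
  { intros x Hx. apply Rnot_lt_le; intro L.
    assert (D := proj1 (is_derive_Reals _ _ _) (Hg x Hx)).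
    destruct (D (- g1 x) ltac:(lra)) as [d Hd].
    pose proof (cond_pos d) as Hdp.
    specialize (Hd (d / 2) ltac:(lra)).
    rewrite Rabs_pos_eq in Hd by lra. specialize (Hd ltac:(lra)).
    apply Rabs_def2 in Hd.
    assert (g x <= g (x + d / 2)) by (apply Hmin; try apply Hle; lra).
    assert (0 <= (g (x + d / 2) - g x) / (d / 2)).
    { apply Rmult_le_pos; [lra|]. left; apply Rinv_0_lt_compat; lra. }
    lra. }
  (* With h = -g, the inequality h'' >= h/4 + e^{-r/2} gives Q' >= Q/2. *)
  set (Q := fun r => - g1 r - g r / 2 + exp (- r / 2)).
  set (Q1 := fun r => - g2 r - g1 r / 2 - exp (- r / 2) / 2).
  assert (HQ : forall r, R0 < r -> is_derive Q r (Q1 r)).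
  { intros r Hr. unfold Q, Q1.
    pose proof (Hg r Hr) as D0. pose proof (Hg1 r Hr) as D1.
    auto_derive.
    - ex_derive_known.
    (* Eta-reduction, so that the [Derive] terms left by [auto_derive] match the known
       derivatives. *)
    - change (fun x : R => g1 x) with g1. change (fun x : R => g x) with g.
      rewrite (is_derive_unique _ _ _ D0), (is_derive_unique _ _ _ D1).
      unfold Rdiv. ring. }
  assert (HQ1 : forall r, R0 < r -> Q r / 2 <= Q1 r).
  { intros r Hr. unfold Q, Q1. specialize (Hsup r Hr (Hle r Hr)).
    assert (0 < / r) by (apply Rinv_0_lt_compat; lra).
    assert (0 <= / r * g1 r) by (apply Rmult_le_pos; [lra|auto]).
    lra. }
  (* Since Q' >= Q/2, a positive value of Q would force growth like e^{r/2}, but Q is bounded above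
     because g is nondecreasing and g' >= 0. *)
  assert (HQneg : forall r, R0 < r -> Q r <= 0).
  { intros r Hr. apply Rnot_lt_le; intro P.
    assert (Hinc : forall x, r <= x -> Q r * exp (- r / 2) <= Q x * exp (- x / 2)).
    { intros x Hx.
      apply (nondecreasing_of_derive (fun x => Q x * exp (- x / 2))
        (fun x => (Q1 x - Q x / 2) * exp (- x / 2)) R0); auto.
      - intros y Hy. pose proof (HQ y Hy) as D. auto_derive.
        + ex_derive_known.
        + change (fun x : R => Q x) with Q.
          rewrite (is_derive_unique _ _ _ D). unfold Rdiv. ring.
      - intros y Hy. apply Rmult_le_pos; [|left; apply exp_pos].
        specialize (HQ1 y Hy). lra. }
    assert (Hbd : forall x, r <= x -> Q x <= - g r + 1).
    { intros x Hx. unfold Q.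
      assert (g r <= g x) by (apply Hmin; try apply Hle; lra).
      assert (0 <= g1 x) by (apply Hg1pos; lra).
      assert (g r <= 0) by (apply Hle; lra).
      assert (exp (- x / 2) <= 1).
      { rewrite <- exp_0. left; apply exp_increasing; lra. }
      lra. }
    set (c := Q r * exp (- r / 2)).
    assert (Hc : 0 < c) by (apply Rmult_lt_0_compat; [lra|apply exp_pos]).
    assert (g r <= 0) by (apply Hle; lra).
    (* Chosen so that c (1 + x/2) already exceeds the bound - g r + 1. *)
    set (x := Rmax r (2 * ((- g r + 1) / c))).
    assert (r <= x) by apply Rmax_l.
    assert (Hx2 : 2 * ((- g r + 1) / c) <= x) by apply Rmax_r.
    specialize (Hinc x ltac:(lra)). specialize (Hbd x ltac:(lra)).
    fold c in Hinc.
    pose proof (exp_half_sq x) as Ex. pose proof (exp_pos (x / 2)).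
    assert (Hcx : c * exp (x / 2) <= - g r + 1).
    { assert (c * exp (x / 2) <= Q x * exp (- x / 2) * exp (x / 2))
        by (apply Rmult_le_compat_r; lra).
      nra. }
    assert (1 + x / 2 < exp (x / 2)) by (apply exp_ineq1; lra).
    assert (c * ((- g r + 1) / c) = - g r + 1) by (field; lra).
    nra. }
  (* With h = -g, the derivative of h e^{r/2} + r is e^{r/2} Q <= 0. As h >= 0, this quantity is at
     least r, so it cannot stay below its initial value [C]; the point C + 1 gives the
     contradiction. *)
  assert (Hdec : forall x y, R0 < x -> x <= y ->
      - g y * exp (y / 2) + y <= - g x * exp (x / 2) + x).
  { apply (nonincreasing_of_derive (fun x => - g x * exp (x / 2) + x)
      (fun x => exp (x / 2) * Q x)).
    - intros y Hy. pose proof (Hg y Hy) as D. auto_derive.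
      + ex_derive_known.
      + change (fun x : R => g x) with g.
        rewrite (is_derive_unique _ _ _ D). unfold Q.
        pose proof (exp_half_sq y) as Ey. unfold Rdiv in *.
        rewrite !Rmult_plus_distr_l, Ey. ring.
    - intros y Hy. specialize (HQneg y Hy). pose proof (exp_pos (y / 2)). nra. }
  set (x := R0 + 1).
  set (C := - g x * exp (x / 2) + x).
  assert (HC : x <= C).
  { unfold C. assert (g x <= 0) by (apply Hle; unfold x; lra).
    pose proof (exp_pos (x / 2)). nra. }
  specialize (Hdec x (C + 1) ltac:(unfold x; lra) ltac:(lra)). fold C in Hdec.
  assert (g (C + 1) <= 0) by (apply Hle; unfold x in *; lra).
  pose proof (exp_pos ((C + 1) / 2)). nra.
Qed.

(** * Flux bound for a Liouville-type inequality *)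

(** The flux r V' has derivative r Delta V <= 0, which bounds it above. Below, either it never
    passes -3, or e^V decays fast enough for r Delta V to be integrable. *)
Lemma liouville_flux_bounded (V V1 V2 : R -> R) (R0 K : R) :
  0 <= R0 -> 0 <= K ->
  (forall r, R0 < r -> is_derive V r (V1 r)) ->
  (forall r, R0 < r -> is_derive V1 r (V2 r)) ->
  (forall r, R0 < r -> - K * exp (V r) <= V2 r + / r * V1 r <= 0) ->
  exists B R1, 0 < B /\ R0 <= R1 /\ forall r, R1 < r -> Rabs (r * V1 r) <= B.
Proof.
  intros HR0 HK HV HV1 HD.
  assert (Hp : forall r, R0 < r ->
      is_derive (fun r => r * V1 r) r (r * (V2 r + / r * V1 r))).
  { intros r Hr. pose proof (HV1 r Hr) as D. auto_derive.
    - ex_derive_known.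
    - change (fun x : R => V1 x) with V1.
      rewrite (is_derive_unique _ _ _ D). field. lra. }
  assert (Hdec : forall x y, R0 < x -> x <= y -> y * V1 y <= x * V1 x).
  { apply (nonincreasing_of_derive (fun r => r * V1 r) _ R0 Hp).
    intros r Hr. specialize (HD r Hr). nra. }
  assert (Hlow : exists C R1, R0 < R1 /\ forall r, R1 < r -> C <= r * V1 r).
  (* Any threshold below -2 would make r e^V integrable; -3 keeps the exponents integral. *)
  { destruct (classic (exists x, R0 < x /\ x * V1 x < -3)) as [[x [Hx Hx3]]|N].
    - assert (H3 : forall r, x <= r -> r * V1 r < -3).
      { intros r Hr. specialize (Hdec x r Hx Hr). lra. }
      (* r V' < -3 makes r^3 e^V nonincreasing, so r e^V = O(r^-2) is integrable. *)
      set (A := x ^ 3 * exp (V x)).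
      assert (HA : forall r, x < r -> r ^ 3 * exp (V r) <= A).
      { intros r Hr. unfold A.
        destruct (MVT_cor2 (fun r => r ^ 3 * exp (V r))
          (fun r => r ^ 2 * exp (V r) * (3 + r * V1 r)) x r Hr) as [c [E Hc]].
        - intros c Hc. apply is_derive_Reals.
          pose proof (HV c ltac:(lra)) as D. auto_derive.
          + ex_derive_known.
          + change (fun x : R => V x) with V.
            rewrite (is_derive_unique _ _ _ D). ring.
        - specialize (H3 c ltac:(lra)).
          assert (0 < c ^ 2 * exp (V c)).
          { apply Rmult_lt_0_compat; [apply pow_lt; lra|apply exp_pos]. }
          assert (0 <= c ^ 2 * exp (V c) * (- (3 + c * V1 c)) * (r - x))
            by (apply Rmult_le_pos; [apply Rmult_le_pos|]; lra).
          lra. }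
      exists ((x + 1) * V1 (x + 1) - K * A / (x + 1)), (x + 1).
      split; [lra|]. intros r Hr.
      assert (HAp : 0 < A).
      { apply Rmult_lt_0_compat; [apply pow_lt; lra|apply exp_pos]. }
      (* The correction - K A / r has derivative K A / r^2, which compensates the largest possible
         decrease of the flux. *)
      assert (M : (x + 1) * V1 (x + 1) - K * A / (x + 1) <= r * V1 r - K * A / r).
      { apply (nondecreasing_of_derive (fun r => r * V1 r - K * A / r)
          (fun r => r * (V2 r + / r * V1 r) + K * A / r ^ 2) x); try lra.
        - intros y Hy. pose proof (HV1 y ltac:(lra)) as D. auto_derive.
          + ex_derive_known.
          + change (fun x : R => V1 x) with V1.
            rewrite (is_derive_unique _ _ _ D). field. lra.
        - intros y Hy. specialize (HA y Hy).
          destruct (HD y ltac:(lra)) as [L _].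
          assert (Hy2 : 0 < y ^ 2) by (apply pow_lt; lra).
          assert (y * exp (V y) <= A / y ^ 2).
          { apply Rmult_le_reg_r with (y ^ 2); [lra|].
            replace (A / y ^ 2 * y ^ 2) with A by (field; lra). lra. }
          assert (y * (- K * exp (V y)) <= y * (V2 y + / y * V1 y))
            by (apply Rmult_le_compat_l; lra).
          assert (K * (y * exp (V y)) <= K * (A / y ^ 2))
            by (apply Rmult_le_compat_l; lra).
          unfold Rdiv in *. lra. }
      assert (0 <= K * A / r).
      { apply Rmult_le_pos; [nra|]. left; apply Rinv_0_lt_compat; lra. }
      lra.
    - exists (-3), (R0 + 1). split; [lra|]. intros r Hr.
      apply Rnot_lt_le; intro L. apply N. exists r. lra. }
  destruct Hlow as [C [R1 [HR1 HC]]].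
  exists (Rabs C + Rabs (R1 * V1 R1) + 1), R1.
  pose proof (Rabs_pos C). pose proof (Rabs_pos (R1 * V1 R1)).
  repeat split; try lra.
  intros r Hr. specialize (HC r Hr). specialize (Hdec R1 r HR1 ltac:(lra)).
  pose proof (Rle_abs (R1 * V1 R1)). pose proof (Rle_abs (- C)) as HC'.
  rewrite Rabs_Ropp in HC'. apply Rabs_le. lra.
Qed.

(** * Limits of exponentials and factored nonlinearities *)

Lemma is_lim_exp_m_infty (w : R -> R) :
  is_lim w p_infty m_infty -> is_lim (fun r => exp (w r)) p_infty 0.
Proof.
  intros H. apply (is_lim_comp exp w p_infty 0 m_infty); auto.
  - apply is_lim_exp_m.
  - exists 0. intros; discriminate.
Qed.

Lemma is_lim_exp_ln_half (w : R -> R) :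
  is_lim w p_infty (ln (1 / 2)) -> is_lim (fun r => exp (w r)) p_infty (1 / 2).
Proof.
  intros H. rewrite <- (exp_ln (1 / 2)) by lra.
  apply (is_lim_comp_continuous w exp); auto.
  apply continuity_pt_filterlim, derivable_continuous_pt, derivable_pt_exp.
Qed.

Lemma f1_factor u v r : f1 u v r = exp (u r) * (1 - 2 * exp (u r) + exp (v r)).
Proof.
  unfold f1. replace (2 * u r) with (u r + u r) by ring.
  rewrite !exp_plus. ring.
Qed.

Lemma f2_eq_f1_swap u v r : f2 u v r = f1 v u r.
Proof. unfold f1, f2. now rewrite (Rplus_comm (u r)). Qed.

(** The system reads Delta u = -2 f_1 + f_2, Delta v = f_1 - 2 f_2, with both terms in factored
    form. *)
Lemma rhs_factor a b :
  rhs a b = - 2 * (exp a * (1 - 2 * exp a + exp b)) +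
            exp b * (1 - 2 * exp b + exp a).
Proof.
  unfold rhs. replace (2 * a) with (a + a) by ring.
  replace (2 * b) with (b + b) by ring. rewrite !exp_plus. ring.
Qed.

(** * Positivity of f_1 in the two asymptotic regimes *)

Lemma f1_pos_of_vanishing (u v : R -> R) :
  is_lim u p_infty m_infty ->
  exists R0, forall r, R0 < r -> 0 < f1 u v r.
Proof.
  intros Hu. apply is_lim_exp_m_infty, is_lim_spec in Hu.
  destruct (Hu (mkposreal (1 / 2) ltac:(lra))) as [M HM]; simpl in HM.
  exists M. intros r Hr. specialize (HM r Hr). apply Rabs_def2 in HM.
  rewrite f1_factor. apply Rmult_lt_0_compat; [apply exp_pos|].
  pose proof (exp_pos (v r)). lra.
Qed.

Lemma f1_pos_of_half (u v : R -> R) :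
  twice_derivable u -> twice_derivable v ->
  (forall r, 0 < r -> radial_laplacian u r = rhs (u r) (v r)) ->
  (forall r, 0 < r -> radial_laplacian v r = rhs (v r) (u r)) ->
  is_lim u p_infty (ln (1 / 2)) -> is_lim v p_infty m_infty ->
  exists R0, forall r, R0 < r -> 0 < f1 u v r.
Proof.
  intros Hu Hv Eu Ev Lu Lv.
  set (u1 := Derive u) in *. set (v1 := Derive v) in *.
  set (u2 := Derive u1). set (v2 := Derive v1).
  assert (Du : forall r, 0 < r -> is_derive u r (u1 r))
    by (intros; apply Derive_correct; now apply Hu).
  assert (Dv : forall r, 0 < r -> is_derive v r (v1 r))
    by (intros; apply Derive_correct; now apply Hv).
  assert (Du1 : forall r, 0 < r -> is_derive u1 r (u2 r))
    by (intros; apply Derive_correct; now apply Hu).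
  assert (Dv1 : forall r, 0 < r -> is_derive v1 r (v2 r))
    by (intros; apply Derive_correct; now apply Hv).
  assert (Eu' : forall r, 0 < r -> u2 r + / r * u1 r = rhs (u r) (v r))
    by (intros r Hr; exact (Eu r Hr)).
  assert (Ev' : forall r, 0 < r -> v2 r + / r * v1 r = rhs (v r) (u r))
    by (intros r Hr; exact (Ev r Hr)).
  clear Eu Ev Hu Hv.
  pose proof (is_lim_exp_ln_half _ Lu) as Ha.
  pose proof (is_lim_exp_m_infty _ Lv) as Hb.
  (* The weight 1/2 cancels f_1 in the Laplacian. *)
  set (V := fun r => v r + u r / 2).
  set (V1 := fun r => v1 r + u1 r / 2).
  set (V2 := fun r => v2 r + u2 r / 2).
  assert (DV : forall r, 0 < r -> is_derive V r (V1 r)).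
  { intros r Hr. pose proof (Du r Hr) as D. pose proof (Dv r Hr) as D'.
    unfold V, V1. auto_derive.
    - ex_derive_known.
    - change (fun x : R => u x) with u. change (fun x : R => v x) with v.
      rewrite (is_derive_unique _ _ _ D), (is_derive_unique _ _ _ D').
      unfold Rdiv; ring. }
  assert (DV1 : forall r, 0 < r -> is_derive V1 r (V2 r)).
  { intros r Hr. pose proof (Du1 r Hr) as D. pose proof (Dv1 r Hr) as D'.
    unfold V1, V2. auto_derive.
    - ex_derive_known.
    - change (fun x : R => u1 x) with u1. change (fun x : R => v1 x) with v1.
      rewrite (is_derive_unique _ _ _ D), (is_derive_unique _ _ _ D').
      unfold Rdiv; ring. }
  assert (Hclose : exists R0, 0 <= R0 /\ forall r, R0 < r ->
      9 / 20 < exp (u r) < 11 / 20 /\ exp (v r) < 1 / 100).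
  { apply is_lim_spec in Ha, Hb.
    destruct (Ha (mkposreal (1 / 20) ltac:(lra))) as [M HM]; simpl in HM.
    destruct (Hb (mkposreal (1 / 100) ltac:(lra))) as [M' HM']; simpl in HM'.
    exists (Rmax 0 (Rmax M M')). split; [apply Rmax_l|]. intros r Hr.
    apply Rmax_Rlt in Hr as [Hr0 Hr]. apply Rmax_Rlt in Hr as [Hr1 Hr2].
    specialize (HM r Hr1). specialize (HM' r Hr2).
    apply Rabs_def2 in HM, HM'. lra. }
  destruct Hclose as [R0 [HR0 Hcl]].
  assert (Hun : forall r, R0 < r -> -2 < u r < 0).
  { intros r Hr. destruct (Hcl r Hr) as [[Ha1 Ha2] _].
    split; apply exp_lt_inv.
    - pose proof (exp_ineq1 2 ltac:(lra)) as E2.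
      replace (-2) with (- (2)) by ring. rewrite exp_Ropp.
      apply Rlt_trans with (/ 3); [|lra].
      apply Rinv_lt_contravar; nra.
    - rewrite exp_0. lra. }
  (* Here 1 - 2 e^v + e^u < 3 gives f_2 <= 3 e^v, and u > -2 gives e^v <= e e^V. *)
  destruct (liouville_flux_bounded V V1 V2 R0 (9 / 2 * exp 1)) as
      [B [R1 [HB [HR1 Hflux]]]]; auto.
  { pose proof (exp_pos 1). lra. }
  { intros; apply DV; lra. }
  { intros; apply DV1; lra. }
  { intros r Hr. destruct (Hcl r Hr) as [[Ha1 Ha2] Hb1].
    pose proof (exp_pos (v r)) as Hb0.
    replace (V2 r + / r * V1 r) with
      ((v2 r + / r * v1 r) + (u2 r + / r * u1 r) / 2)
      by (unfold V2, V1, Rdiv; ring).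
    rewrite Eu', Ev', !rhs_factor by lra.
    assert (Hbv : exp (v r) <= exp 1 * exp (V r)).
    { rewrite <- exp_plus. left. apply exp_increasing. unfold V.
      destruct (Hun r Hr). lra. }
    split; nra. }
  set (R2 := Rmax R1 (4 * B)).
  assert (HV1 : forall r, R2 < r -> - (1 / 4) < V1 r < 1 / 4).
  { intros r Hr. apply Rmax_Rlt in Hr as [Hr1 Hr2].
    specialize (Hflux r Hr1). apply Rabs_le_between in Hflux. nra. }
  assert (HR2 : R1 <= R2) by apply Rmax_l.
  assert (HVlow : exists R3, R2 <= R3 /\
      forall r, R3 < r -> exp (- r / 2) <= exp (v r)).
  { set (x := R2 + 1).
    (* V' > -1/4 costs at most r/4, and this threshold absorbs V(x) into another r/4. Since u < 0, v
       exceeds V. *)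
    exists (Rmax x (4 * (- V x))).
    split; [apply Rle_trans with x; [unfold x; lra|apply Rmax_l]|].
    intros r Hr. apply Rmax_Rlt in Hr as [Hr1 Hr2].
    assert (M : V x + x / 4 <= V r + r / 4).
    { apply (nondecreasing_of_derive (fun r => V r + r / 4)
        (fun r => V1 r + 1 / 4) R2); try (unfold x in *; lra).
      - intros y Hy. pose proof (DV y ltac:(lra)) as D. auto_derive.
        + ex_derive_known.
        + change (fun x : R => V x) with V.
          rewrite (is_derive_unique _ _ _ D). unfold Rdiv; ring.
      - intros y Hy. specialize (HV1 y Hy). lra. }
    left. apply exp_increasing. unfold V in M at 2.
    assert (- 2 < u r < 0) by (apply Hun; unfold x in *; lra).
    unfold x in *; lra. }
  destruct HVlow as [R3 [HR3 Hvlow]].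
  set (g := fun r => 1 - 2 * exp (u r) + exp (v r)).
  set (g1 := fun r => - 2 * exp (u r) * u1 r + exp (v r) * v1 r).
  set (g2 := fun r => - 2 * exp (u r) * (u2 r + u1 r ^ 2) +
                      exp (v r) * (v2 r + v1 r ^ 2)).
  destruct (eventually_positive_of_superharmonic g g1 g2 R3) as [R4 HR4].
  { lra. }
  { intros r Hr. pose proof (Du r ltac:(lra)) as D.
    pose proof (Dv r ltac:(lra)) as D'.
    unfold g, g1. auto_derive.
    - ex_derive_known.
    - change (fun x : R => u x) with u. change (fun x : R => v x) with v.
      rewrite (is_derive_unique _ _ _ D), (is_derive_unique _ _ _ D'). ring. }
  { intros r Hr. pose proof (Du r ltac:(lra)) as D.
    pose proof (Dv r ltac:(lra)) as D'.
    pose proof (Du1 r ltac:(lra)) as D1.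
    pose proof (Dv1 r ltac:(lra)) as D1'.
    unfold g1, g2. auto_derive.
    - ex_derive_known.
    - change (fun x : R => u x) with u. change (fun x : R => v x) with v.
      change (fun x : R => u1 x) with u1. change (fun x : R => v1 x) with v1.
      rewrite (is_derive_unique _ _ _ D), (is_derive_unique _ _ _ D'),
        (is_derive_unique _ _ _ D1), (is_derive_unique _ _ _ D1'). ring. }
  { unfold g. evar_last.
    - apply is_lim_plus'; [|exact Hb].
      apply is_lim_minus'; [apply is_lim_const|].
      apply (is_lim_scal_l _ 2 _ _ Ha).
    - simpl. f_equal. lra. }
  { intros r Hr Hgr.
    replace (g2 r + / r * g1 r) with
      (- 2 * exp (u r) * (u2 r + / r * u1 r) +
       exp (v r) * (v2 r + / r * v1 r) +
       (- 2 * exp (u r) * u1 r ^ 2 + exp (v r) * v1 r ^ 2))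
      by (unfold g2, g1; ring).
    rewrite Eu', Ev', !rhs_factor by lra.
    specialize (Hvlow r Hr). specialize (HV1 r ltac:(lra)).
    destruct (Hcl r ltac:(lra)) as [[Ha1 Ha2] Hb1].
    pose proof (exp_pos (v r)) as Hb0.
    unfold g in *. unfold V1 in HV1.
    revert Hgr Hvlow Ha1 Ha2 Hb1 Hb0 HV1.
    generalize (exp (- r / 2)) (u1 r) (v1 r).
    generalize (exp (u r)) (exp (v r)). intros a b e p q.
    set (G := 1 - 2 * a + b). intros Hgr Hvlow Ha1 Ha2 Hb1 Hb0 HV1.
    (* Only V' = q + p/2 is known to be small; the remaining p^2 is absorbed by -2 a p^2. *)
    assert (Hsq : - 2 * a * p ^ 2 + b * q ^ 2 <= b / 8).
    { assert (q ^ 2 <= 2 * (q + p / 2) ^ 2 + p ^ 2 / 2)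
        by (pose proof (pow2_ge_0 (q + p)); lra).
      assert ((q + p / 2) ^ 2 <= 1 / 16) by nra.
      assert (0 <= p ^ 2) by apply pow2_ge_0.
      assert (b * q ^ 2 <= b * (1 / 8 + p ^ 2 / 2))
        by (apply Rmult_le_compat_l; lra).
      nra. }
    (* Delta g = (4a^2 + ab) G - 2aF - 2bF + (gradient terms). The excess b/8 here pays for the
       gradient terms, leaving -b <= - e^{-r/2}. *)
    assert (HF : 9 / 8 * b <= 2 * a * (b * (1 - 2 * b + a))).
    { assert (9 / 8 <= 2 * a * (1 - 2 * b + a)) by nra. nra. }
    assert (HF' : 0 <= b * (b * (1 - 2 * b + a))).
    { apply Rmult_le_pos; [lra|]. apply Rmult_le_pos; lra. }
    assert (HG : (4 * a ^ 2 + a * b) * G <= G / 4).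
    { clearbody G. assert (1 / 4 <= 4 * a ^ 2 + a * b) by nra. nra. }
    clearbody G. set (F := b * (1 - 2 * b + a)) in *. clearbody F. lra. }
  exists R4. intros r Hr. rewrite f1_factor.
  apply Rmult_lt_0_compat; [apply exp_pos|]. exact (HR4 r Hr).
Qed.

(** * Conclusion by the symmetry exchanging u and v *)

Theorem corollary1p6 (N1 N2 : R) (hN1 : 0 <= N1) (hN2 : 0 <= N2)
    (u v : R -> R) (hsol : entire_radial_solution N1 N2 u v)
    (htype : non_topological u v \/ mixed_type u v) :
  exists R0 : R, 0 < R0 /\ forall r : R, R0 < r -> 0 < f1 u v r /\ 0 < f2 u v r.
Proof.
  destruct hsol as [Hu [Hv [Eu [Ev _]]]].
  assert (H : (exists R1, forall r, R1 < r -> 0 < f1 u v r) /\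
              (exists R2, forall r, R2 < r -> 0 < f1 v u r)).
  (* In each case a component tending to -oo is handled directly, and one tending to log (1/2) has a
     partner tending to -oo. *)
  { destruct htype as [[Lu Lv]|[[Lu Lv]|[Lu Lv]]]; split;
      auto using f1_pos_of_vanishing, f1_pos_of_half. }
  destruct H as [[R1 H1] [R2 H2]].
  exists (Rmax 1 (Rmax R1 R2)).
  split; [apply Rlt_le_trans with 1; [lra|apply Rmax_l]|].
  intros r Hr. apply Rmax_Rlt in Hr as [_ Hr]. apply Rmax_Rlt in Hr as [Hr1 Hr2].
  rewrite f2_eq_f1_swap. auto.
Qed.
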